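(* Let $G$ be a connected subcubic graph (simple, maximum degree at most $3$) with at least two vertices. Then $G$ is decomposable unless $G$ is isomorphic to one of the following eight graphs: (1) $K_3$; (2) $K_4$; (3) $K_{3,3}$; (4) $K_4-e$ (the graph obtained from $K_4$ by deleting one edge); (5) $K_{2,3}$; (6) the graph obtained from $K_4$ by subdividing exactly one edge once; (7) the graph obtained from $K_4$ by subdividing once each of two disjoint edges; (8) the graph obtained from $K_{3,3}$ by subdividing exactly one edge once. None of these eight graphs is decomposable.
   Context: All graphs are finite and simple. A graph is subcubic if every vertex has degree at most $3$. A matching $M$ of a graph $G$ is called separating if $G-M$ has more connected components than $G$. A matching cut of $G$ is a matching $M$ that is an edge cut, i.e. $M$ is the set of all edges between $X$ and $V(G)\setminus X$ for some nonempty proper subset $X\subseteq V(G)$. A graph is decomposable if it has a matching cut (equivalently, a separating matching). Subdividing an edge $xy$ once means replacing it by a path $x\,w\,y$ through a new vertex $w$. *)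

(* Defs.v *)
From mathcomp Require Import all_boot.
Set Implicit Arguments.
Unset Strict Implicit.
Unset Printing Implicit Defensive.

Record sgraph := SGraph {
  vertex :> finType;
  adj : rel vertex;
  adj_sym : symmetric adj;
  adj_irrefl : irreflexive adj }.

Notation "x -- y" := (adj x y) (at level 30).

Section Notions.
Variable G : sgraph.

Definition edges : {set {set G}} :=
  [set E | [exists x, exists y, (x -- y) && (E == [set x; y])]].

Definition degree (x : G) : nat := #|[set y | x -- y]|.

Definition subcubic : Prop := forall x : G, degree x <= 3.

Definition connected : Prop := forall x y : G, connect (@adj G) x y.

Definition matching (M : {set {set G}}) : Prop :=
  M \subset edges /\ trivIset M.

Definition edges_across (X : {set G}) : {set {set G}} :=
  [set E in edges | [exists x in X, exists y in ~: X, E == [set x; y]]].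

Definition edge_cut (M : {set {set G}}) : Prop :=
  exists X : {set G}, [/\ X != set0, X \proper [set: G] & M = edges_across X].

Definition matching_cut (M : {set {set G}}) : Prop :=
  matching M /\ edge_cut M.

Definition decomposable : Prop := exists M, matching_cut M.

End Notions.

Definition isomorphic (G H : sgraph) : Prop :=
  exists2 f : G -> H, bijective f & forall x y, (f x -- f y) = (x -- y).

Definition complete_rel n : rel 'I_n := fun x y => x != y.

Lemma complete_sym n : symmetric (@complete_rel n).
Proof. by move=> x y; rewrite /complete_rel eq_sym. Qed.

Lemma complete_irrefl n : irreflexive (@complete_rel n).
Proof. by move=> x; rewrite /complete_rel eqxx. Qed.

Definition complete n : sgraph :=
  SGraph (@complete_sym n) (@complete_irrefl n).

Definition bipartite_rel m n : rel ('I_m + 'I_n)%type := fun u v =>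
  match u, v with
  | inl _, inr _ | inr _, inl _ => true
  | _, _ => false
  end.

Lemma bipartite_sym m n : symmetric (@bipartite_rel m n).
Proof. by move=> [x|x] [y|y]. Qed.

Lemma bipartite_irrefl m n : irreflexive (@bipartite_rel m n).
Proof. by move=> [x|x]. Qed.

Definition complete_bipartite m n : sgraph :=
  SGraph (@bipartite_sym m n) (@bipartite_irrefl m n).

Section EdgeOperations.
Variables (G : sgraph) (a b : G).

Definition del_rel : rel G :=
  fun x y => (x -- y) && ([set x; y] != [set a; b]).

Lemma del_sym : symmetric del_rel.
Proof. by move=> x y; rewrite /del_rel adj_sym setUC. Qed.

Lemma del_irrefl : irreflexive del_rel.
Proof. by move=> x; rewrite /del_rel adj_irrefl. Qed.

Definition delete_edge : sgraph := SGraph del_sym del_irrefl.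

(* None is the new vertex; this is the subdivision of the edge ab
   only when a -- b. *)
Definition subdiv_rel : rel (option G) := fun u v =>
  match u, v with
  | Some x, Some y => del_rel x y
  | Some x, None | None, Some x => x \in [set a; b]
  | None, None => false
  end.

Lemma subdiv_sym : symmetric subdiv_rel.
Proof. by move=> [x|] [y|] //=; rewrite del_sym. Qed.

Lemma subdiv_irrefl : irreflexive subdiv_rel.
Proof. by move=> [x|] //=; rewrite del_irrefl. Qed.

Definition subdivide : sgraph := SGraph subdiv_sym subdiv_irrefl.

End EdgeOperations.

Notation K3 := (complete 3).
Notation K4 := (complete 4).
Notation K33 := (complete_bipartite 3 3).
Notation K23 := (complete_bipartite 2 3).

Definition v0 : K4 := @Ordinal 4 0 isT.
Definition v1 : K4 := @Ordinal 4 1 isT.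
Definition v2 : K4 := @Ordinal 4 2 isT.
Definition v3 : K4 := @Ordinal 4 3 isT.

Definition K4_minus_edge : sgraph := delete_edge v0 v1.

Definition K4_subdiv1 : sgraph := subdivide v0 v1.

Definition K4_subdiv2 : sgraph := @subdivide K4_subdiv1 (Some v2) (Some v3).

Definition K33_subdiv1 : sgraph :=
  @subdivide K33 (inl ord0) (inr ord0).

Definition exceptional (G : sgraph) : Prop :=
  isomorphic G K3 \/ isomorphic G K4 \/ isomorphic G K33 \/
  isomorphic G K4_minus_edge \/ isomorphic G K23 \/
  isomorphic G K4_subdiv1 \/ isomorphic G K4_subdiv2 \/
  isomorphic G K33_subdiv1.

(* Main.v *)
Require Import Defs.
From mathcomp Require Import all_boot zify.
Set Implicit Arguments.
Unset Strict Implicit.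
Unset Printing Implicit Defensive.

(** Let [G] be subcubic and indecomposable, and let [X] be a vertex set in which
    every vertex has two neighbours. Each vertex of [X] then has at most one
    neighbour outside, so either [X] is everything or some outside vertex has two
    neighbours in [X] and can be absorbed.

    Take [X] of minimum size among the nonempty sets that span at least as many
    edges as they have vertices. Removing single vertices shows that [X] is
    2-regular. If [w] outside has two neighbours in [X], then exchanging [w] for a
    vertex [u] of [X] not adjacent to [w] gives another such set, and the
    2-regularity of both makes [u] adjacent to every neighbour of [w]; hence
    [#|X| <= 4] and [G] contains a triangle or a square.

    Absorption from a triangle passes through [K3], [K4] or [K4] minus an edge, and
    [K4] with one subdivided edge; from a square in a triangle-free graph it passes
    through [K23], then [K33] or [K33] minus an edge, and [K33] with one subdivided
    edge. At every stage the degree bound leaves no further possibility.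

    Conversely no matching cut splits a triangle or [K23], and absorption preserves
    this; each exceptional graph is obtained by absorption from one of the two. *)

Lemma eq_set2 (T : finType) (x y a b : T) :
  ([set x; y] == [set a; b]) = (x == a) && (y == b) || (x == b) && (y == a).
Proof.
apply/eqP/idP => [eq_xy|/orP[]/andP[/eqP-> /eqP->]]; rewrite 1?setUC //.
have := set21 x y; have := set22 x y; rewrite eq_xy !inE.
have := set21 a b; have := set22 a b; rewrite -eq_xy !inE.
rewrite ![_ == x]eq_sym ![_ == y]eq_sym.
by case: (x == a) (x == b) (y == a) (y == b) => [] [] [] [].
Qed.

(** * Neighbourhoods and matching cuts *)

Section MatchingCuts.
Variable G : sgraph.
Implicit Types (a b c x y z w : G) (X : {set G}) (s : seq G) (E : {set G}).

Lemma adj_neq x y : x -- y -> x != y.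
Proof. by apply: contraTneq => ->; rewrite adj_irrefl. Qed.

Lemma adj_symE (e : bool) x y : x -- y = e -> (x -- y = e) * (y -- x = e).
Proof. by move=> xy; rewrite [y -- x]adj_sym. Qed.

Lemma adj3_symE x a b c : all (adj x) [:: a; b; c] ->
  ((x -- a = true) * (a -- x = true)) * ((x -- b = true) * (b -- x = true)) *
  ((x -- c = true) * (c -- x = true)).
Proof. by case/and4P=> xa xb xc _; rewrite ![_ -- x]adj_sym xa xb xc. Qed.

Definition nbrs X x : {set G} := [set y in X | x -- y].

Lemma count_nbrs x s : uniq s -> count (adj x) s = #|nbrs [set y in s] x|.
Proof.
move=> Us; rewrite -size_filter -(card_uniqP (filter_uniq _ Us)).
by apply: eq_card => y; rewrite !inE mem_filter andbC.
Qed.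

Lemma degree_nbrs x : degree x = #|nbrs setT x|.
Proof. by apply: eq_card => y; rewrite !inE. Qed.

Lemma degree_split X x : degree x = #|nbrs X x| + #|nbrs (~: X) x|.
Proof.
rewrite /degree -(cardsID X); congr (_ + _); apply: eq_card => y;
  by rewrite !inE andbC.
Qed.

Lemma leq_nbrs_degree X x : #|nbrs X x| <= degree x.
Proof. by rewrite (degree_split X) leq_addr. Qed.

Definition cross X x : {set G} := [set y | (x -- y) && ((y \in X) != (x \in X))].

Lemma cross_in X x : x \in X -> cross X x = nbrs (~: X) x.
Proof. by move=> xX; apply/setP => y; rewrite !inE xX eqb_id andbC. Qed.

Lemma cross_out X x : x \notin X -> cross X x = nbrs X x.
Proof.
by move=> /negbTE xX; apply/setP => y; rewrite !inE xX eqbF_neg negbK andbC.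
Qed.

Lemma cross_edge X x y : y \in cross X x -> [set x; y] \in edges_across X.
Proof.
rewrite !inE => /andP[xy side]; apply/andP; split.
  by apply/existsP; exists x; apply/existsP; exists y; rewrite xy /=.
case: (boolP (x \in X)) side => xX; case: (boolP (y \in X)) => // yX _.
  by apply/existsP; exists x; rewrite xX; apply/existsP; exists y; rewrite inE yX /=.
apply/existsP; exists y; rewrite yX; apply/existsP; exists x.
by rewrite inE xX setUC /=.
Qed.

Lemma edge_cross X E x : E \in edges_across X -> x \in E ->
  exists2 y, y \in cross X x & E = [set x; y].
Proof.
rewrite !inE => /andP[/existsP[a /existsP[b /andP[ab /eqP->]]]].
case/existsP=> u /andP[uX /existsP[v /andP[]]]; rewrite !inE => vX.
have side : (a \in X) != (b \in X) -> (x == a) || (x == b) ->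
    exists2 y, y \in cross X x & [set a; b] = [set x; y].
  move=> ne /orP[]/eqP->.
    by exists b; rewrite // inE ab eq_sym.
  by exists a; rewrite 1?setUC // inE adj_sym ab.
rewrite eq_set2 => uv; apply: side.
by case/orP: uv => /andP[/eqP-> /eqP->]; rewrite uX (negbTE vX).
Qed.

Lemma matching_edges_across X :
  matching (edges_across X) <-> forall x, #|cross X x| <= 1.
Proof.
split=> [[_ /trivIsetP disj] x | cross1].
  apply/card_le1_eqP => y z Cy Cz; apply/eqP/negPn/negP => neq_zy.
  have neq_xz : x != z by apply: adj_neq; case/setIdP: Cz.
  have neq : [set x; y] != [set x; z].
    by rewrite eq_set2 eqxx (negbTE neq_xz) orbF eq_sym.
  have /pred0P/(_ x) := disj _ _ (cross_edge Cy) (cross_edge Cz) neq.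
  by rewrite /= !inE eqxx.
split; first by apply/subsetP => E /setIdP[].
apply/trivIsetP => E F EX FX; apply: contraR => /pred0Pn[x /andP[/= xE xF]].
have [y Cy ->] := edge_cross EX xE; have [z Cz ->] := edge_cross FX xF.
by rewrite (card_le1_eqP (cross1 x) _ _ Cy Cz).
Qed.

Definition cut_side X : bool :=
  [&& X != set0, X != setT & [forall x, #|cross X x| <= 1]].

Lemma decomposableP : reflect (decomposable G) [exists X, cut_side X].
Proof.
apply: (iffP existsP) => [[X /and3P[X0 XT /forallP/matching_edges_across mX]]|].
  by exists (edges_across X); split; last by exists X; rewrite properT.
case=> _ [/[swap] -[X [X0 XT ->]] /matching_edges_across cross1].
by exists X; rewrite /cut_side X0 -properT XT; apply/forallP.
Qed.

(* Otherwise [X] itself would be one side of a matching cut. *)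
Lemma absorption X : ~ decomposable G -> X != set0 -> X != setT ->
    {in X, forall x, #|nbrs (~: X) x| <= 1} ->
  exists2 w, w \notin X & 1 < #|nbrs X w|.
Proof.
move=> indec X0 XT inX1.
have [w /andP[wX w2]|noW] := pickP [pred w | (w \notin X) && (1 < #|nbrs X w|)].
  by exists w.
case: indec; apply/decomposableP/existsP; exists X; rewrite /cut_side X0 XT.
apply/forallP => x; have [xX|xX] := boolP (x \in X).
  by rewrite cross_in // inX1.
by rewrite cross_out //; have := noW x; rewrite /= xX ltnNge => /negbFE.
Qed.

Lemma subcubic_absorption X : subcubic G -> ~ decomposable G ->
    X != set0 -> X != setT -> {in X, forall x, 1 < #|nbrs X x|} ->
  exists2 w, w \notin X & 1 < #|nbrs X w|.
Proof.
move=> G3 indec X0 XT X2; apply: absorption => // x xX.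
by rewrite -(leq_add2l 2) (leq_trans _ (G3 x)) // (degree_split X) leq_add2r X2.
Qed.

Lemma indecomposable_degree :
  ~ decomposable G -> 1 < #|G| -> forall x, 1 < degree x.
Proof.
move=> indec G2 x; rewrite ltnNge; apply/negP => x1.
have [|||w _] := @absorption [set x] indec.
- by rewrite -card_gt0 cards1.
- by apply: contraTneq G2 => xT; rewrite -cardsT -xT cards1.
- move=> y /set1P->; apply: leq_trans x1.
  by rewrite (degree_split [set x]) leq_addl.
rewrite ltnNge => /negP[]; rewrite -(cards1 x).
by apply/subset_leq_card/subsetP => y /setIdP[].
Qed.

(* Absorb into [[set x; y]]. *)
Lemma degree2_edge_triangle x y :
    ~ decomposable G -> 2 < #|G| -> x -- y -> degree x <= 2 -> degree y <= 2 ->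
  exists w, x -- w /\ y -- w.
Proof.
move=> indec cardG xy x2 y2.
have XT : [set x; y] != setT.
  by apply: contraTneq cardG => XT; rewrite -cardsT -XT cards2 -leqNgt; case: (_ != _).
have one_outside u v : u -- v -> v \in [set x; y] -> degree u <= 2 ->
    #|nbrs (~: [set x; y]) u| <= 1.
  move=> uv vX u2; rewrite -(leq_add2l 1) (leq_trans _ u2) //.
  rewrite (degree_split [set x; y]) leq_add2r card_gt0.
  by apply/set0Pn; exists v; rewrite inE vX.
have [||w wX] := @absorption [set x; y] indec _ XT.
- by apply/set0Pn; exists x; rewrite set21.
- move=> u; rewrite !inE => /orP[]/eqP->.
    by apply: (one_outside _ y); rewrite ?set22.
  by apply: (one_outside _ x); rewrite ?set21 // adj_sym.
case/card_gt1P=> a [b []]; rewrite !inE => /andP[ea wa] /andP[eb wb] neq_ab.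
exists w; rewrite ![_ -- w]adj_sym.
by case/orP: ea wa neq_ab => /eqP-> wa; case/orP: eb wb => /eqP-> wb;
  rewrite ?eqxx // => _.
Qed.

End MatchingCuts.

(** * Dense vertex sets *)

Section DenseSets.
Variable G : sgraph.
Implicit Types (a b c d x y z w u : G) (X Y : {set G}).

Definition degree_sum X : nat := \sum_(x in X) #|nbrs X x|.

Lemma card_nbrsD1 X x y : y \in X -> #|nbrs X x| = (x -- y) + #|nbrs (X :\ y) x|.
Proof.
move=> yX; rewrite (cardsD1 y (nbrs X x)) inE yX; congr (_ + _).
by apply: eq_card => z; rewrite !inE andbA.
Qed.

Lemma card_nbrs_swap X u w x : u \in X -> w \notin X ->
  (x -- u) + #|nbrs (w |: X :\ u) x| = (x -- w) + #|nbrs X x|.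
Proof.
move=> uX wX; have wXu : w \notin X :\ u by rewrite !inE (negbTE wX) andbF.
by rewrite (card_nbrsD1 x (setU11 w _)) setU1K // (card_nbrsD1 x uX) addnCA.
Qed.

Lemma nbrs_sub X x : nbrs X x \subset X :\ x.
Proof.
apply/subsetP => y; rewrite !inE => /andP[-> xy].
by rewrite eq_sym adj_neq.
Qed.

Lemma degree_sumD1 X x : x \in X ->
  degree_sum X = degree_sum (X :\ x) + #|nbrs X x|.*2.
Proof.
move=> xX; have card_sum : #|nbrs X x| = \sum_(y in X :\ x) (x -- y).
  rewrite -sum1_card (eq_bigl (fun y => (y \in X :\ x) && (x -- y))) => [|y].
    by rewrite big_mkcondr; apply: eq_bigr => y _; case: (x -- y).
  by rewrite !inE; case: eqVneq => // ->; rewrite adj_irrefl andbF.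
rewrite /degree_sum (big_setD1 x) //= -addnn addnA addnC; congr (_ + _).
rewrite card_sum -big_split; apply: eq_bigr => y _ /=.
by rewrite (card_nbrsD1 y xX) adj_sym addnC.
Qed.

Lemma degree_sum_even X : ~~ odd (degree_sum X).
Proof.
have [n leXn] := ubnP #|X|; elim: n X leXn => // n IHn X.
have [->|[x xX]] := set_0Vmem X; first by rewrite /degree_sum big_set0.
rewrite (cardsD1 x) xX ltnS => /IHn.
by rewrite (degree_sumD1 xX) oddD odd_double addbF.
Qed.

Lemma leq_degree_sum X k :
  {in X, forall x, k <= #|nbrs X x|} -> #|X| * k <= degree_sum X.
Proof. by move=> Xk; rewrite -sum_nat_const leq_sum. Qed.

(* Equivalently, [X] spans at least as many edges as it has vertices. *)
Definition dense X : bool := (X != set0) && (#|X|.*2 <= degree_sum X).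

Lemma dense_min_degree2 X : X != set0 -> {in X, forall x, 1 < #|nbrs X x|} -> dense X.
Proof. by move=> X0 X2; rewrite /dense X0 -muln2 leq_degree_sum. Qed.

Definition triangle x y z : bool := [&& x -- y, y -- z & x -- z].

Lemma dense_triangle x y z : triangle x y z -> dense [set x; y; z].
Proof.
case/and3P=> xy yz xz; have adjE := (adj_symE xy, adj_symE yz, adj_symE xz).
apply: dense_min_degree2 => [|u]; first by apply/set0Pn; exists x; rewrite !inE eqxx.
rewrite !inE => /orP[/orP[]|] /eqP->; apply/card_gt1P.
- by exists y, z; rewrite !inE !eqxx !adjE !orbT adj_neq.
- by exists x, z; rewrite !inE !eqxx !adjE !orbT adj_neq.
- by exists x, y; rewrite !inE !eqxx !adjE !orbT adj_neq.
Qed.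

Definition min_dense X : Prop := dense X /\ forall Y, dense Y -> #|X| <= #|Y|.

Lemma ex_min_dense : 0 < #|G| -> (forall x, 1 < degree x) -> exists X, min_dense X.
Proof.
move=> G0 deg2; have denseT : dense setT.
  apply: dense_min_degree2 => [|x _]; first by rewrite -card_gt0 cardsT.
  by rewrite -degree_nbrs.
by case: (arg_minnP (fun X : {set G} => #|X|) denseT) => X; exists X.
Qed.

Lemma min_dense_remove X x : min_dense X -> x \in X ->
  degree_sum X + 2 < #|X|.*2 + #|nbrs X x|.*2.
Proof.
case=> /andP[X0 densX] minX xX; have sum_x := degree_sumD1 xX.
have card_x := cardsD1 x X; rewrite xX in card_x.
have Xx0 : X :\ x != set0.
  apply/eqP => Xx0; have := subset_leq_card (nbrs_sub X x).
  rewrite Xx0 cards0 /degree_sum big_set0 in card_x sum_x *.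
  by move: densX; rewrite /degree_sum sum_x card_x; lia.
have : ~~ dense (X :\ x) by apply/negP => /minX; lia.
by rewrite /dense Xx0 -ltnNge; lia.
Qed.

Definition two_regular X : Prop := {in X, forall x, #|nbrs X x| = 2}.

Lemma min_dense_regular X : subcubic G -> min_dense X -> two_regular X.
Proof.
move=> G3 mX; have [/andP[_ densX] _] := mX.
have remove x xX := @min_dense_remove X x mX xX.
have deg2 x : x \in X -> 1 < #|nbrs X x| by move=> /remove; lia.
move=> x xX; apply/eqP; rewrite eqn_leq andbC deg2 // leqNgt; apply/negP => x3.
have sum_gt : #|X|.*2 < degree_sum X.
  rewrite (cardsD1 x X) xX /degree_sum (big_setD1 x) //=.
  have : #|X :\ x| * 2 <= \sum_(y in X :\ x) #|nbrs X y|.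
    by rewrite -sum_nat_const leq_sum // => y /setD1P[_ /deg2].
  by lia.
have sum_ge : #|X| * 3 <= degree_sum X.
  by apply: leq_degree_sum => y /remove; have := degree_sum_even X; lia.
have := subset_leq_card (nbrs_sub X x); have := cardsD1 x X; rewrite xX.
by have := leq_nbrs_degree X x; have := G3 x; have := remove x xX; lia.
Qed.

Lemma min_dense_exchange X w u : min_dense X -> two_regular X ->
    w \notin X -> 1 < #|nbrs X w| -> u \in X -> ~~ (w -- u) ->
  min_dense (w |: X :\ u).
Proof.
move=> [/andP[X0 densX] minX] reg wX w2 uX wu; set Y := w |: X :\ u.
have wXu : w \notin X :\ u by rewrite !inE (negbTE wX) andbF.
have cardY : #|Y| = #|X| by rewrite cardsU1 wXu (cardsD1 u X) uX.
split=> [|Z /minX]; last by rewrite cardY.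
have -> : dense Y = (#|X|.*2 <= degree_sum Y).
  by rewrite /dense cardY -card_gt0 cardY card_gt0 X0.
have := card_nbrs_swap w uX wX; rewrite (negbTE wu) adj_irrefl -/Y => nbrs_w.
have := degree_sumD1 (setU11 w (X :\ u)); rewrite setU1K // -/Y.
by have := degree_sumD1 uX; rewrite (reg u uX); lia.
Qed.

Lemma min_dense_outside X w : subcubic G -> min_dense X ->
  w \notin X -> 1 < #|nbrs X w| -> #|X| <= 4.
Proof.
move=> G3 mX wX w2; have reg := min_dense_regular G3 mX.
have [x /setIdP[xX wx]] : exists x, x \in nbrs X w.
  by apply/set0Pn; rewrite -card_gt0 ltnW.
have swap u : u \in X :\: nbrs X w -> #|nbrs X w| = 2 /\ u \in nbrs X x.
  rewrite !inE => /andP[/nandP[/negP//|wu] uX].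
  have regY := min_dense_regular G3 (min_dense_exchange mX reg wX w2 uX wu).
  have xu : x != u by apply: contraNneq wu => <-.
  have := card_nbrs_swap w uX wX; have := card_nbrs_swap x uX wX.
  rewrite adj_irrefl (negbTE wu) uX reg // !regY ?inE ?eqxx ?xu ?xX ?orbT //.
  by rewrite adj_sym [x -- w]adj_sym wx; case: (u -- x) => //; lia.
have card_nonnbrs : #|X :\: nbrs X w| <= 2.
  by rewrite -(reg x xX) subset_leq_card //; apply/subsetP => u /swap[].
have := cardsID (nbrs X w) X; have := subset_leq_card (subsetIr X (nbrs X w)).
have := leq_nbrs_degree X w; have := G3 w.
by have [->|[u /swap[->]]] := set_0Vmem (X :\: nbrs X w); rewrite ?cards0; lia.
Qed.

Lemma min_dense_spanning : subcubic G -> ~ decomposable G ->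
  min_dense [set: G] -> #|G| <= 4.
Proof.
move=> G3 indec mT; have reg := min_dense_regular G3 mT.
have deg2 x : degree x <= 2 by rewrite degree_nbrs reg ?inE.
have [//|G5] := leqP #|G| 4.
have [/andP[/set0Pn[x _] _] minT] := mT.
have /card_gt0P[y] : 0 < #|nbrs setT x| by rewrite reg ?inE.
rewrite !inE /= => xy.
have [w [xw yw]] := degree2_edge_triangle indec (ltnW (ltnW G5)) xy (deg2 x) (deg2 y).
have xyw : triangle x y w by rewrite /triangle xy yw.
have := minT _ (dense_triangle xyw).
by rewrite cardsT setUC cardsU1 cards2; lia.
Qed.

Lemma min_dense_le4 X : subcubic G -> ~ decomposable G -> min_dense X -> #|X| <= 4.
Proof.
move=> G3 indec mX; have [/andP[X0 _] _] := mX.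
have [XT|XT] := eqVneq X setT.
  by rewrite XT in mX *; rewrite cardsT min_dense_spanning.
have [|w wX w2] := subcubic_absorption G3 indec X0 XT.
  by move=> x xX; rewrite (min_dense_regular G3 mX).
exact: min_dense_outside wX w2.
Qed.

Definition square a b c d : bool :=
  [&& a -- b, b -- c, c -- d, d -- a, a != c & b != d].

Lemma two_regular_triangle_or_square X :
    X != set0 -> two_regular X -> #|X| <= 4 ->
  (exists x y z : G, triangle x y z) \/ (exists a b c d : G, square a b c d).
Proof.
case/set0Pn=> b bX reg X4.
have /eqP/cards2P[a [c [neq_ac def_ac]]] := reg b bX.
have [/setIdP[aX ba] /setIdP[cX bc]] : a \in nbrs X b /\ c \in nbrs X b.
  by rewrite def_ac !inE !eqxx orbT.
have [ac|ac] := boolP (a -- c).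
  by left; exists a, b, c; rewrite /triangle adj_sym ba bc.
have /card_gt0P[d] : 0 < #|nbrs X a :\ b|.
  by move: (reg a aX); rewrite (cardsD1 b); case: (b \in _); lia.
case/setD1P=> neq_db /setIdP[dX ad].
have bd : ~~ (b -- d).
  have : d \notin nbrs X b.
    by rewrite def_ac !inE negb_or eq_sym adj_neq //=; apply: contraNneq ac => <-.
  by rewrite inE dX.
(* [X] has only two vertices other than [b] and [d]. *)
have /eqP nbrs_d : nbrs X d == X :\ d :\ b.
  rewrite eqEcard reg // subsetD1 nbrs_sub inE adj_sym (negbTE bd) andbF /=.
  by move: X4; rewrite (cardsD1 d X) dX (cardsD1 b (X :\ d)) !inE bX eq_sym neq_db.
have : c \in nbrs X d.
  rewrite nbrs_d !inE cX [c == b]eq_sym adj_neq //= andbT.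
  by apply: contraNneq ac => ->.
rewrite inE => /andP[_ dc]; right; exists a, b, c, d.
by rewrite /square ![_ -- a]adj_sym [c -- d]adj_sym adj_sym ba bc dc ad neq_ac eq_sym.
Qed.

Lemma triangle_or_square : subcubic G -> ~ decomposable G -> 1 < #|G| ->
  (exists x y z : G, triangle x y z) \/ (exists a b c d : G, square a b c d).
Proof.
move=> G3 indec G2.
have [X mX] := ex_min_dense (ltnW G2) (indecomposable_degree indec G2).
have [/andP[X0 _] _] := mX.
apply: two_regular_triangle_or_square X0 (min_dense_regular G3 mX) _.
exact: min_dense_le4.
Qed.

End DenseSets.

(** * Isomorphism from adjacency tables *)

Fixpoint upper_adj (T : Type) (e : rel T) (s : seq T) : seq bitseq :=
  if s is x :: s' then map (e x) s' :: upper_adj e s' else [::].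

Lemma size_upper_adj (T : Type) (e : rel T) s : size (upper_adj e s) = size s.
Proof. by elim: s => //= x s ->. Qed.

Lemma upper_adj_nth (T U : Type) (e : rel T) (f : rel U) x0 y0 s t i j :
    symmetric e -> irreflexive e -> symmetric f -> irreflexive f ->
    upper_adj e s = upper_adj f t -> i < size s -> j < size s ->
  e (nth x0 s i) (nth x0 s j) = f (nth y0 t i) (nth y0 t j).
Proof.
move=> e_sym e_irr f_sym f_irr; elim: s t i j => // x s IHs [|y t] // i j.
move=> [eq_row eq_st]; have eq_size : size s = size t.
  by rewrite -(size_map (e x)) eq_row size_map.
have head k : k < size s -> e x (nth x0 s k) = f y (nth y0 t k).
  move=> ltk; rewrite -(nth_map _ false) // eq_row (nth_map y0) //.
  by rewrite -eq_size.
case: i j => [|i] [|j] /= lti ltj; first by rewrite e_irr f_irr.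
- exact: head.
- by rewrite e_sym f_sym; apply: head.
- exact: IHs.
Qed.

Lemma upper_adj_isomorphic (G H : sgraph) (s : seq G) (t : seq H) :
    uniq s -> (forall x, x \in s) -> uniq t -> size t = #|H| -> 0 < #|H| ->
    upper_adj (@adj G) s = upper_adj (@adj H) t ->
  isomorphic G H.
Proof.
move=> Us sT Ut size_t H0 eq_adj.
have eq_size : size s = size t.
  by rewrite -(size_upper_adj (@adj G)) eq_adj size_upper_adj.
have index_s x : index x s < size s by rewrite index_mem.
have /card_gt0P[y0 _] := H0.
have x0 : G by case: (s) eq_size => [/esym|//]; rewrite size_t; case: #|H| H0.
exists (fun x => nth y0 t (index x s)).
  apply: inj_card_bij => [x y /eqP|].
    by rewrite nth_uniq -?eq_size // => /eqP/(index_inj x0); apply.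
  by rewrite -size_t -eq_size -(card_uniqP Us) max_card.
move=> x y; rewrite -(@upper_adj_nth _ _ (@adj G) _ x0 _ s) ?nth_index //;
  by [exact: adj_sym | exact: adj_irrefl].
Qed.

(** * Absorption from a triangle or a square *)

Local Notation ord2 k := (@Ordinal 2 k isT).
Local Notation ord3 k := (@Ordinal 3 k isT).

Lemma del_relE (G : sgraph) (a b x y : G) :
  del_rel a b x y = (x -- y) && ~~ ((x == a) && (y == b) || (x == b) && (y == a)).
Proof. by rewrite /del_rel eq_set2. Qed.

Section Classification.
Variable G : sgraph.
Hypotheses (G3 : subcubic G) (indec : ~ decomposable G).
Implicit Types (a b c d u w x y z : G) (s : seq G).

Lemma count_adj_le3 x s : uniq s -> count (adj x) s <= 3.
Proof. by move=> Us; rewrite count_nbrs // (leq_trans (leq_nbrs_degree _ _)). Qed.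

Lemma saturated s x y : uniq (y :: s) -> 2 < count (adj x) s -> y -- x = false.
Proof.
move=> Uys x3; apply/negP => yx; have := count_adj_le3 x Uys.
by rewrite /= adj_sym yx leqNgt ltnS x3.
Qed.

Definition inner s : bool := all (fun x => 1 < count (adj x) s) s.

Lemma spans_or_extends s : s != [::] -> uniq s -> inner s ->
  (forall x, x \in s) \/ exists2 w, uniq (w :: s) & 1 < count (adj w) s.
Proof.
move=> s0 Us /allP s_inner; have [sT|sT] := eqVneq [set x in s] setT.
  by left=> x; have := in_setT x; rewrite -sT inE.
right; have [||w] := subcubic_absorption G3 indec _ sT.
- by case: (s) s0 => // x ? _; apply/set0Pn; exists x; rewrite !inE eqxx.
- by move=> x; rewrite inE -count_nbrs // => /s_inner.
by rewrite inE -count_nbrs // => ws; exists w; rewrite //= ws.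
Qed.

Lemma isomorphic_or_extends (H : sgraph) s (t : seq H) :
    uniq s -> inner s -> upper_adj (@adj G) s = upper_adj (@adj H) t ->
    uniq t -> size t = #|H| -> 0 < #|H| ->
  isomorphic G H \/ exists2 w, uniq (w :: s) & 1 < count (adj w) s.
Proof.
move=> Us s_inner eq_adj Ut size_t H0.
have [|//|//|sT|] := @spans_or_extends s; last by right.
  by rewrite -size_eq0 -(size_upper_adj (@adj G)) eq_adj size_upper_adj size_t -lt0n.
by left; apply: upper_adj_isomorphic eq_adj.
Qed.

Lemma count_adj_saturated w u s : uniq [:: w, u & s] ->
    all (fun x => 2 < count (adj x) (u :: s)) s ->
  count (adj w) (u :: s) <= 1.
Proof.
move=> Uwus /allP sat; rewrite /= [count _ s](_ : _ = 0) ?addn0 ?leq_b1 //.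
apply/eqP; rewrite -leqn0 leqNgt -has_count; apply/hasPn => x xs.
by rewrite (saturated Uwus) ?sat.
Qed.

Lemma complete4_exceptional a b c d :
    triangle a b c -> all (adj d) [:: a; b; c] -> exceptional G.
Proof.
case/and3P=> ab bc ac dabc.
have adjE := (adj_symE ab, adj_symE bc, adj_symE ac, adj3_symE dabc).
have U : uniq [:: a; b; c; d] by rewrite /= !inE !negb_or !adj_neq // ?adjE.
have [|||||iso|[w Uw]] :=
  @isomorphic_or_extends K4 _ [:: v0; v1; v2; v3] U; rewrite ?card_ord //.
- by rewrite /inner /= !adjE !adj_irrefl.
- by rewrite /= !adjE.
- by rewrite /exceptional; tauto.
by rewrite /= !(saturated Uw) //= !adjE !adj_irrefl.
Qed.

Lemma diamond_exceptional a b c d :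
    triangle a b c -> all (adj d) [:: a; b] -> c != d -> c -- d = false ->
  exceptional G.
Proof.
case/and3P=> ab bc ac /and3P[da db _] neq_cd cd.
have adjE := (adj_symE ab, adj_symE bc, adj_symE ac, adj_symE da, adj_symE db,
              adj_symE cd).
have U : uniq [:: c; d; a; b].
  by rewrite /= !inE !negb_or neq_cd !adj_neq // ?adjE.
have [|||||iso|[u Uu]] :=
  @isomorphic_or_extends K4_minus_edge _ [:: v0; v1; v2; v3] U; rewrite ?card_ord //.
- by rewrite /inner /= !adjE !adj_irrefl.
- by rewrite /= !adjE !del_relE.
- by rewrite /exceptional; tauto.
have [ua ub] : u -- a = false /\ u -- b = false.
  by rewrite !(saturated Uu) //= !adjE !adj_irrefl.
rewrite /= ua ub; case uc: (u -- c); case ud: (u -- d) => // _.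
have {}adjE := (adjE, adj_symE ua, adj_symE ub, adj_symE uc, adj_symE ud).
have [|||||iso|[w Uw]] :=
  @isomorphic_or_extends K4_subdiv1 _
    [:: None; Some v0; Some v1; Some v2; Some v3] Uu;
  rewrite ?card_option ?card_ord //.
- by rewrite /inner /= !adjE !adj_irrefl.
- by rewrite /= !adjE !del_relE !inE.
- by rewrite /exceptional; tauto.
by rewrite ltnNge count_adj_saturated //= !adjE !adj_irrefl.
Qed.

Lemma triangle_exceptional a b c : triangle a b c -> exceptional G.
Proof.
move=> abc; have /and3P[ab bc ac] := abc.
have adjE := (adj_symE ab, adj_symE bc, adj_symE ac).
have U : uniq [:: a; b; c] by rewrite /= !inE !negb_or !adj_neq.
have [|||||iso|[w Uw]] :=
  @isomorphic_or_extends K3 _ [:: ord3 0; ord3 1; ord3 2] U; rewrite ?card_ord //.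
- by rewrite /inner /= !adjE !adj_irrefl.
- by rewrite /= !adjE.
- by rewrite /exceptional; tauto.
move: Uw; rewrite /= !inE !negb_or ![w == _]eq_sym => /andP[/and3P[aw bw cw] _].
case wa: (w -- a); case wb: (w -- b); case wc: (w -- c) => // _.
- by apply: (complete4_exceptional (d := w) abc); rewrite /= wa wb wc.
- by apply: (@diamond_exceptional a b c w); rewrite /= ?wa ?wb // adj_sym.
- by apply: (@diamond_exceptional a c b w);
    rewrite /triangle /= ?adjE ?wa ?wc // adj_sym.
- by apply: (@diamond_exceptional b c a w);
    rewrite /triangle /= ?adjE ?wb ?wc // adj_sym.
Qed.

Section TriangleFree.
Hypothesis triangle_free : forall x y z, ~~ triangle x y z.

Lemma common_nbr_nonadjacent y x z : y -- x -> y -- z -> x -- z = false.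
Proof.
move=> yx yz; apply/negP => xz.
by have := triangle_free y x z; rewrite /triangle yx xz yz.
Qed.

Lemma nbrs3_nonadjacent y a b c : all (adj y) [:: a; b; c] ->
  ((a -- b = false) * (b -- a = false)) * ((a -- c = false) * (c -- a = false)) *
  ((b -- c = false) * (c -- b = false)).
Proof.
case/and4P=> ya yb yc _; have nonadj u v (yu : y -- u) (yv : y -- v) :=
  adj_symE (common_nbr_nonadjacent yu yv).
exact: (nonadj a b ya yb, nonadj a c ya yc, nonadj b c yb yc).
Qed.

Lemma biclique33_exceptional x1 x2 x3 y1 y2 y3 :
    uniq [:: x1; x2; x3; y1; y2; y3] ->
    allrel (@adj G) [:: x1; x2; x3] [:: y1; y2; y3] ->
  exceptional G.
Proof.
move=> U /and4P[x1y x2y x3y _].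
have adjE := (adj3_symE x1y, adj3_symE x2y, adj3_symE x3y).
have y1x : all (adj y1) [:: x1; x2; x3] by rewrite /= !adjE.
have {}adjE := (adjE, nbrs3_nonadjacent x1y, nbrs3_nonadjacent y1x).
have [|||||iso|[w Uw]] :=
  @isomorphic_or_extends K33 _
    [:: inl (ord3 0); inl (ord3 1); inl (ord3 2);
        inr (ord3 0); inr (ord3 1); inr (ord3 2)] U;
  rewrite ?card_sum ?card_ord //.
- by rewrite /inner /= !adjE !adj_irrefl.
- by rewrite /= !adjE.
- by rewrite /exceptional; tauto.
by rewrite /= !(saturated Uw) //= !adjE !adj_irrefl.
Qed.

(* [K33] minus an edge is [K4_subdiv2]: each side consists of the ends of one
   subdivided edge and the vertex subdividing the other. *)
Lemma biclique33_minus_edge_exceptional x1 x2 x3 y1 y2 y3 :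
    uniq [:: x1; x2; x3; y1; y2; y3] ->
    allrel (@adj G) [:: x1; x2] [:: y1; y2; y3] ->
    all (adj x3) [:: y1; y2] -> x3 -- y3 = false ->
  exceptional G.
Proof.
move=> U /and3P[x1y x2y _] /and3P[x3y1 x3y2 _] x3y3.
have adjE := (adj3_symE x1y, adj3_symE x2y, adj_symE x3y1, adj_symE x3y2,
              adj_symE x3y3).
have y1x : all (adj y1) [:: x1; x2; x3] by rewrite /= !adjE.
have {}adjE := (adjE, nbrs3_nonadjacent x1y, nbrs3_nonadjacent y1x).
have [|||||iso|[z Uz]] :=
  @isomorphic_or_extends K4_subdiv2 _
    [:: Some (Some v0); Some (Some v1); None;
        Some (Some v2); Some (Some v3); Some None] U;
  rewrite ?card_option ?card_ord //.
- by rewrite /inner /= !adjE !adj_irrefl.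
- by rewrite /= !adjE !del_relE /= !del_relE !inE.
- by rewrite /exceptional; tauto.
have [[zx1 zx2] [zy1 zy2]] : ((z -- x1 = false) * (z -- x2 = false)) *
                             ((z -- y1 = false) * (z -- y2 = false)).
  by rewrite !(saturated Uz) //= !adjE !adj_irrefl.
rewrite /= zx1 zx2 zy1 zy2; case zx3: (z -- x3); case zy3: (z -- y3) => // _.
have {}adjE := (adjE, adj_symE zx1, adj_symE zx2, adj_symE zx3, adj_symE zy1,
                adj_symE zy2, adj_symE zy3).
have [|||||iso|[w Uw]] :=
  @isomorphic_or_extends K33_subdiv1 _
    [:: None; Some (inl (ord3 1)); Some (inl (ord3 2)); Some (inl (ord3 0));
        Some (inr (ord3 1)); Some (inr (ord3 2)); Some (inr (ord3 0))] Uz;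
  rewrite ?card_option ?card_sum ?card_ord //.
- by rewrite /inner /= !adjE !adj_irrefl.
- by rewrite /= !adjE !del_relE !inE.
- by rewrite /exceptional; tauto.
by rewrite ltnNge count_adj_saturated //= !adjE !adj_irrefl.
Qed.

Lemma biclique23_exceptional x1 x2 y1 y2 y3 :
    uniq [:: x1; x2; y1; y2; y3] ->
    allrel (@adj G) [:: x1; x2] [:: y1; y2; y3] ->
  exceptional G.
Proof.
move=> U xy; have /and3P[x1y x2y _] := xy.
have adjE := (adj3_symE x1y, adj3_symE x2y).
have x12 : x1 -- x2 = false.
  by apply: (common_nbr_nonadjacent (y := y1)); rewrite adjE.
have {}adjE := (adjE, nbrs3_nonadjacent x1y, adj_symE x12).
have [|||||iso|[w Uw]] :=
  @isomorphic_or_extends K23 _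
    [:: inl (ord2 0); inl (ord2 1); inr (ord3 0); inr (ord3 1); inr (ord3 2)] U;
  rewrite ?card_sum ?card_ord //.
- by rewrite /inner /= !adjE !adj_irrefl.
- by rewrite /= !adjE.
- by rewrite /exceptional; tauto.
have [wx1 wx2] : w -- x1 = false /\ w -- x2 = false.
  by rewrite !(saturated Uw) //= !adjE !adj_irrefl.
have {}Uw n : uniq ([:: x1; x2; w] ++ rot n [:: y1; y2; y3]).
  rewrite (perm_uniq (s2 := w :: [:: x1; x2; y1; y2; y3])) //.
  by rewrite (perm_catCA [:: x1; x2] [:: w]) !perm_cons perm_rot.
rewrite /= wx1 wx2.
case wy1: (w -- y1); case wy2: (w -- y2); case wy3: (w -- y3) => // _.
- by apply: (biclique33_exceptional (Uw 0)); rewrite /allrel /= !adjE wy1 wy2 wy3.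
- by apply: (biclique33_minus_edge_exceptional (Uw 0)); rewrite //= wy1 wy2.
- by apply: (biclique33_minus_edge_exceptional (Uw 2));
    rewrite /allrel /= ?adjE ?wy1 ?wy3.
- by apply: (biclique33_minus_edge_exceptional (Uw 1));
    rewrite /allrel /= ?adjE ?wy2 ?wy3.
Qed.

Lemma square_diagonals a b c d : square a b c d -> a -- c = false /\ b -- d = false.
Proof.
case/and5P=> ab bc _ da _; split.
  by apply: (common_nbr_nonadjacent (y := b)); rewrite // adj_sym.
by apply: (common_nbr_nonadjacent (y := a)); rewrite // adj_sym.
Qed.

Lemma square_rot a b c d : square a b c d -> square b c d a.
Proof.
by case/and5P=> ab bc cd da /andP[ac bd]; rewrite /square bc cd da ab bd eq_sym ac.
Qed.

Lemma square_uniq a b c d : square a b c d -> uniq [:: a; b; c; d].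
Proof.
case/and5P=> ab bc cd da /andP[ac bd].
by rewrite /= !inE !negb_or ac bd !adj_neq // adj_sym.
Qed.

Lemma square_not_spanning a b c d :
  square a b c d -> ~ (forall x, x \in [:: a; b; c; d]).
Proof.
move=> abcd sT; have U := square_uniq abcd; have [ac bd] := square_diagonals abcd.
have /and5P[ab bc _ da _] := abcd.
have adjE := (adj_symE ab, adj_symE bc, adj_symE da, adj_symE ac, adj_symE bd).
have degree_count x : degree x = count (adj x) [:: a; b; c; d].
  by rewrite count_nbrs // degree_nbrs; apply: eq_card => y; rewrite !in_set sT.
have cardG : 2 < #|G|.
  by rewrite (leq_trans _ (max_card (mem [:: a; b; c; d]))) ?(card_uniqP U).
have [||e [ae be]] := degree2_edge_triangle indec cardG ab.
- by rewrite degree_count /= !adjE adj_irrefl.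
- by rewrite degree_count /= !adjE adj_irrefl.
by have := triangle_free a b e; rewrite /triangle ab ae be.
Qed.

Lemma square_opposite_exceptional a b c d w :
    square a b c d -> uniq (w :: [:: a; b; c; d]) -> w -- a -> w -- c ->
  exceptional G.
Proof.
case/and5P=> ab bc cd da _ U wa wc; apply: (@biclique23_exceptional a c b d w).
  rewrite -(rot_uniq 4) (perm_uniq (s2 := [:: w; a; b; c; d])) //.
  by rewrite !perm_cons (perm_catCA [:: c] [:: b] [:: d]).
by rewrite /allrel /= ab cd ![a -- _]adj_sym da wa ![c -- _]adj_sym bc wc.
Qed.

Lemma square_exceptional a b c d : square a b c d -> exceptional G.
Proof.
move=> abcd; have /and5P[ab bc cd da _] := abcd; have [ac bd] := square_diagonals abcd.
have adjE := (adj_symE ab, adj_symE bc, adj_symE cd, adj_symE da,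
              adj_symE ac, adj_symE bd).
have [//||sT|[w Uw]] := spans_or_extends _ (square_uniq abcd).
- by rewrite /inner /= !adjE !adj_irrefl.
- by case: (square_not_spanning abcd sT).
have Uw_rot : uniq (w :: [:: b; c; d; a]).
  rewrite (perm_uniq (s2 := [:: w; a; b; c; d])) // perm_cons.
  by rewrite (perm_rot 1 [:: a; b; c; d]).
have not_both x y : x -- y -> ~~ (w -- x) || ~~ (w -- y).
  by move=> xy; have := triangle_free w x y; rewrite /triangle xy negb_and.
move: (not_both a b ab) (not_both b c bc) (not_both c d cd) (not_both d a da).
rewrite /=; case wa: (w -- a); case wb: (w -- b); case wc: (w -- c);
  case wd: (w -- d) => //= _ _ _ _ _.
  exact: square_opposite_exceptional abcd Uw wa wc.
exact: square_opposite_exceptional (square_rot abcd) Uw_rot wb wd.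
Qed.

End TriangleFree.

Lemma indecomposable_exceptional : 1 < #|G| -> exceptional G.
Proof.
move=> G2; have [/existsP[x /existsP[y /existsP[z]]]|no_triangle] :=
  boolP [exists x, exists y, exists z : G, triangle x y z].
  exact: triangle_exceptional.
have triangle_free x y z : ~~ triangle x y z.
  apply: contra no_triangle => xyz.
  by apply/existsP; exists x; apply/existsP; exists y; apply/existsP; exists z.
have [[x [y [z xyz]]]|[a [b [c [d abcd]]]]] := triangle_or_square G3 indec G2.
  exact: triangle_exceptional xyz.
exact: square_exceptional abcd.
Qed.

End Classification.

(** * Indecomposability of the exceptional graphs *)

Section Unsplit.
Variable G : sgraph.
Implicit Types (x y z w : G) (X : {set G}) (s t : seq G).

Lemma cut_side_count X x s : cut_side X -> uniq s -> all (adj x) s ->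
  count (fun y => (y \in X) != (x \in X)) s <= 1.
Proof.
case/and3P=> _ _ /forallP/(_ x) cross1 Us /allP xs; apply: leq_trans cross1.
rewrite -size_filter -(card_uniqP (filter_uniq _ Us)) subset_leq_card //.
by apply/subsetP => y; rewrite mem_filter inE => /andP[-> /xs->].
Qed.

Definition unsplit s : Prop :=
  forall X, cut_side X -> exists b, all (fun x => (x \in X) == b) s.

Lemma triangle_unsplit x y z : triangle x y z -> unsplit [:: x; y; z].
Proof.
case/and3P=> xy yz xz X cutX; have adjE := (adj_symE xy, adj_symE yz, adj_symE xz).
have uniq_adj (u v : G) : u -- v -> uniq [:: u; v].
  by move=> uv; rewrite /= inE adj_neq.
have [xN yN zN] :
    [/\ all (adj x) [:: y; z], all (adj y) [:: x; z] & all (adj z) [:: x; y]].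
  by rewrite /= !adjE.
exists (x \in X); move: (cut_side_count cutX (uniq_adj y z yz) xN).
move: (cut_side_count cutX (uniq_adj x z xz) yN).
move: (cut_side_count cutX (uniq_adj x y xy) zN).
by rewrite /=; case: (x \in X); case: (y \in X); case: (z \in X).
Qed.

Lemma biclique23_unsplit x1 x2 y1 y2 y3 :
    uniq [:: x1; x2; y1; y2; y3] ->
    allrel (@adj G) [:: x1; x2] [:: y1; y2; y3] ->
  unsplit [:: x1; x2; y1; y2; y3].
Proof.
move=> U /and3P[x1y x2y _] X cutX; have adjE := (adj3_symE x1y, adj3_symE x2y).
have [Ux Uy] : uniq [:: x1; x2] /\ uniq [:: y1; y2; y3].
  by move: U; rewrite (cat_uniq [:: x1; x2]) => /and3P[].
have side_y y : all (adj y) [:: x1; x2] ->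
    count (fun x => (x \in X) != (y \in X)) [:: x1; x2] <= 1.
  exact: cut_side_count.
exists (x1 \in X); move: (cut_side_count cutX Uy x1y) (cut_side_count cutX Uy x2y).
move: (side_y y1) (side_y y2) (side_y y3); rewrite /= !adjE.
move=> /(_ isT) + /(_ isT) + /(_ isT).
by case: (x1 \in X); case: (x2 \in X); case: (y1 \in X); case: (y2 \in X);
  case: (y3 \in X).
Qed.

Lemma unsplit_absorb s w : unsplit s -> uniq s -> 1 < count (adj w) s ->
  unsplit (w :: s).
Proof.
move=> s_unsplit Us w2 X cutX; have [b sb] := s_unsplit X cutX.
exists b; rewrite /= sb andbT; apply: contraTT w2 => wb; rewrite -leqNgt.
have : all (fun y => (y \in X) != (w \in X)) (filter (adj w) s).
  by apply/allP => y; rewrite mem_filter => /andP[_ /(allP sb)/eqP->]; rewrite eq_sym.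
rewrite all_count => /eqP count_filter_s; rewrite -size_filter -count_filter_s.
exact: cut_side_count cutX (filter_uniq _ Us) (filter_all _ _).
Qed.

Fixpoint absorbs s t : bool :=
  if t is w :: t' then [&& w \notin s, 1 < count (adj w) s & absorbs (w :: s) t']
  else true.

Lemma unsplit_spanning s : unsplit s -> (forall x, x \in s) -> ~ decomposable G.
Proof.
move=> s_unsplit sT /decomposableP/existsP[X cutX].
have [b /allP sb] := s_unsplit X cutX; have /and3P[/eqP X0 /eqP XT _] := cutX.
case: b sb => sb; [apply: XT | apply: X0]; apply/setP => x; rewrite inE;
  exact/eqP/sb.
Qed.

Lemma absorbs_indecomposable s t : unsplit s -> uniq s -> absorbs s t ->
  size s + size t = #|G| -> ~ decomposable G.
Proof.
elim: t s => [|w t IHt] s s_unsplit Us /=.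
  rewrite addn0 => _ size_s; apply: unsplit_spanning s_unsplit _ => x.
  have /subset_cardP/(_ _) -> : #|s| = #|G| by rewrite (card_uniqP Us).
    by [].
  exact/subsetP.
case/and3P=> ws w2 abs; rewrite addnS => size_st.
by apply: (IHt (w :: s)); rewrite //= ?ws //; apply: unsplit_absorb.
Qed.

Lemma triangle_absorbs_indecomposable x y z t :
    triangle x y z -> absorbs [:: x; y; z] t -> 3 + size t = #|G| ->
  ~ decomposable G.
Proof.
move=> xyz; apply: absorbs_indecomposable; first exact: triangle_unsplit.
by case/and3P: xyz => xy yz xz; rewrite /= !inE negb_or !adj_neq.
Qed.

Lemma biclique23_absorbs_indecomposable x1 x2 y1 y2 y3 t :
    uniq [:: x1; x2; y1; y2; y3] ->
    allrel (@adj G) [:: x1; x2] [:: y1; y2; y3] ->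
    absorbs [:: x1; x2; y1; y2; y3] t -> 5 + size t = #|G| ->
  ~ decomposable G.
Proof.
by move=> U xy; apply: absorbs_indecomposable; first exact: biclique23_unsplit.
Qed.

End Unsplit.

Lemma decomposable_isomorphic (G H : sgraph) :
  isomorphic G H -> decomposable G -> decomposable H.
Proof.
case=> f [g fK gK] f_adj /decomposableP/existsP[X /and3P[X0 XT /forallP cross1]].
have f_inj := can_inj fK; apply/decomposableP/existsP; exists (f @: X).
apply/and3P; split; first by rewrite imset_eq0.
  move: XT; rewrite -!subTset => /subsetPn[x _ xX].
  by apply/subsetPn; exists (f x); rewrite ?mem_imset.
apply/forallP => y; rewrite -(gK y); apply: leq_trans (cross1 (g y)).
have -> : cross (f @: X) (f (g y)) = f @: cross X (g y); last by rewrite card_imset.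
by apply/setP => z; rewrite -(gK z) inE !mem_imset // inE f_adj.
Qed.

Lemma K3_indecomposable : ~ decomposable K3.
Proof.
by apply: (@triangle_absorbs_indecomposable K3 (ord3 0) (ord3 1) (ord3 2) [::]);
  rewrite ?card_ord.
Qed.

Lemma K4_indecomposable : ~ decomposable K4.
Proof.
by apply: (@triangle_absorbs_indecomposable K4 v0 v1 v2 [:: v3]); rewrite ?card_ord.
Qed.

Lemma K33_indecomposable : ~ decomposable K33.
Proof.
by apply: (@biclique23_absorbs_indecomposable K33 (inl (ord3 0)) (inl (ord3 1))
    (inr (ord3 0)) (inr (ord3 1)) (inr (ord3 2)) [:: inl (ord3 2)]);
  rewrite ?card_sum ?card_ord.
Qed.

Lemma K4_minus_edge_indecomposable : ~ decomposable K4_minus_edge.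
Proof.
by apply: (@triangle_absorbs_indecomposable K4_minus_edge v0 v2 v3 [:: v1]);
  rewrite ?card_ord // /triangle /= !del_relE.
Qed.

Lemma K23_indecomposable : ~ decomposable K23.
Proof.
by apply: (@biclique23_absorbs_indecomposable K23 (inl (ord2 0)) (inl (ord2 1))
    (inr (ord3 0)) (inr (ord3 1)) (inr (ord3 2)) [::]);
  rewrite ?card_sum ?card_ord.
Qed.

Lemma K4_subdiv1_indecomposable : ~ decomposable K4_subdiv1.
Proof.
by apply: (@triangle_absorbs_indecomposable K4_subdiv1 (Some v0) (Some v2) (Some v3)
    [:: Some v1; None]);
  rewrite ?card_option ?card_ord // /triangle /= !del_relE ?inE.
Qed.

Lemma K4_subdiv2_indecomposable : ~ decomposable K4_subdiv2.
Proof.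
by apply: (@biclique23_absorbs_indecomposable K4_subdiv2
    (Some (Some v0)) (Some (Some v1)) (Some (Some v2)) (Some (Some v3)) (Some None) [:: None]);
  rewrite ?card_option ?card_ord /allrel /= ?del_relE /= ?del_relE ?inE.
Qed.

Lemma K33_subdiv1_indecomposable : ~ decomposable K33_subdiv1.
Proof.
by apply: (@biclique23_absorbs_indecomposable K33_subdiv1
    (Some (inl (ord3 1))) (Some (inl (ord3 2))) (Some (inr (ord3 0)))
    (Some (inr (ord3 1))) (Some (inr (ord3 2))) [:: Some (inl (ord3 0)); None]);
  rewrite ?card_option ?card_sum ?card_ord /allrel /= ?del_relE ?inE.
Qed.

Theorem theorem1 :
  (forall G : sgraph, connected G -> subcubic G -> 2 <= #|G| ->
     ~ exceptional G -> decomposable G) /\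
  (forall H : sgraph, exceptional H -> ~ decomposable H).
Proof.
split=> [G _ G3 G2 nonexceptional | H exceptionalH decomposableH].
  have [//|indec] := decomposableP G.
  by case: nonexceptional; apply: indecomposable_exceptional.
have transfer K : isomorphic H K -> decomposable K.
  by move=> iso; apply: decomposable_isomorphic decomposableH.
case: exceptionalH => [/transfer/K3_indecomposable//|].
case=> [/transfer/K4_indecomposable//|].
case=> [/transfer/K33_indecomposable//|].
case=> [/transfer/K4_minus_edge_indecomposable//|].
case=> [/transfer/K23_indecomposable//|].
case=> [/transfer/K4_subdiv1_indecomposable//|].
case=> [/transfer/K4_subdiv2_indecomposable//|/transfer/K33_subdiv1_indecomposable//].
Qed.
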